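(* Let $C$ be a simply laced and bipartite generalized Cartan matrix with $I=I_+\sqcup I_-$, and let $\ell\ge2$. For $\varepsilon\in\{+,-\}$, let $\mathcal{T}^\circ_\ell(C)_\varepsilon$ be the subring of $\mathcal{T}^\circ_\ell(C)$ (for $U=\mathbb{Z}$) generated by those $T^{(a)}_m(u)$ ($a\in I$; $m=1,\dots,\ell-1$; $u\in\mathbb{Z}$) satisfying $\varepsilon(a)(-1)^{m+1+u}=\varepsilon$. Then: (1) $\mathcal{T}^\circ_2(C)_\varepsilon$ is isomorphic to $\mathcal{A}_T(B,x)$ with $B=B(C)$ by the correspondence $T^{(a)}_1(u)\mapsto x_a(u)$. (2) For $\ell\ge3$, $\mathcal{T}^\circ_\ell(C)_\varepsilon$ is isomorphic to $\mathcal{A}_T(B,x)$ with $B=B(C)\square B(C')$ by the correspondence $T^{(a)}_m(u)\mapsto x_{am}(u)$, where $C'$ is the Cartan matrix of type $A_{\ell-1}$ with $I'_+=\{1,3,\dots\}$ and $I'_-=\{2,4,\dots\}$.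
   Context: A generalized Cartan matrix is an integer matrix $C=(C_{ij})_{i,j\in I}$ ($I$ finite) with $C_{ii}=2$, $C_{ij}\le0$ for $i\neq j$, and $C_{ij}=0$ iff $C_{ji}=0$. It is simply laced if $C_{ij}\in\{0,-1\}$ for $i\ne j$ (hence symmetric), and bipartite if $I=I_+\sqcup I_-$ such that $C_{ij}<0$ implies $(i,j)\in I_+\times I_-$ or $(i,j)\in I_-\times I_+$. $\varepsilon(a)=\pm$ for $a\in I_\pm$; the signs $+,-$ are identified with $1,-1$. Write $a\sim b$ if $C_{ab}<0$. For $C$ simply laced, $\mathcal{T}_\ell(C)$ (with $U=\mathbb{Z}$) is the commutative ring over $\mathbb{Z}$ with generators $T^{(a)}_m(u)^{\pm1}$ ($a\in I$; $m=1,\dots,\ell-1$; $u\in\mathbb{Z}$) and the relations of the level $\ell$ restricted T-system $\mathbb{T}_\ell(C)$: $$T^{(a)}_m(u-1)T^{(a)}_m(u+1)=T^{(a)}_{m-1}(u)T^{(a)}_{m+1}(u)+\prod_{b:b\sim a}T^{(b)}_m(u),\qquad T^{(a)}_0(u)=T^{(a)}_\ell(u)=1.$$ $\mathcal{T}^\circ_\ell(C)$ is the subring of $\mathcal{T}_\ell(C)$ generated by all $T^{(a)}_m(u)$. For bipartite $C$, $B(C)$ is the matrix on $I$ with $B_{ij}=-C_{ij}$ for $(i,j)\in I_+\times I_-$, $B_{ij}=C_{ij}$ for $(i,j)\in I_-\times I_+$, $B_{ij}=0$ otherwise. For bipartite $C$ on $I=I_+\sqcup I_-$ and $C'$ on $I'=I'_+\sqcup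 I'_-$, write $\mathbf i:(++)$ if $\mathbf i=(i,i')\in I_+\times I'_+$, etc. The square product $B=B(C)\square B(C')$ is the matrix on $I\times I'$ with, for $\mathbf i=(i,i')$, $\mathbf j=(j,j')$: $B_{\mathbf i\mathbf j}=-C_{ij}\delta_{i'j'}$ if $\mathbf i:(-+),\mathbf j:(++)$ or $\mathbf i:(+-),\mathbf j:(--)$; $B_{\mathbf i\mathbf j}=C_{ij}\delta_{i'j'}$ if $\mathbf i:(++),\mathbf j:(-+)$ or $\mathbf i:(--),\mathbf j:(+-)$; $B_{\mathbf i\mathbf j}=-\delta_{ij}C'_{i'j'}$ if $\mathbf i:(++),\mathbf j:(+-)$ or $\mathbf i:(--),\mathbf j:(-+)$; $B_{\mathbf i\mathbf j}=\delta_{ij}C'_{i'j'}$ if $\mathbf i:(+-),\mathbf j:(++)$ or $\mathbf i:(-+),\mathbf j:(--)$; $0$ otherwise. Its index set is decomposed as $(I\times I')_+=(I_+\times I'_+)\sqcup(I_-\times I'_-)$, $(I\times I')_-=(I_+\times I'_-)\sqcup(I_-\times I'_+)$. Let $B$ be a skew-symmetrizable matrix on a finite set $J=J_+\sqcup J_-$ (for $B=B(C)$: $J=I$ and $J_\pm=I_\pm$; for $B=B(C)\square B(C')$: $J=I\times I'$ and $J_\pm=(I\times I')_\pm$) with $B_{ij}\ne0$ only if $i,j$ lie in different parts, and $\mu_+(B)=\mu_-(B)=-B$ (both $B(C)$ and $B(C)\square B(C')$ satisfy these conditions). Here the mutation at $k$ sends $(B,x)$ to $(B',x')$, $B'_{ij}=-B_{ij}$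 if $i=k$ or $j=k$, $B'_{ij}=B_{ij}+\frac12(|B_{ik}|B_{kj}+B_{ik}|B_{kj}|)$ otherwise; $x'_i=x_i$ for $i\ne k$, $x'_k=\frac1{x_k}\left(\prod_{j:B_{jk}>0}x_j^{B_{jk}}+\prod_{j:B_{jk}<0}x_j^{-B_{jk}}\right)$; and $\mu_\pm=\prod_{k\in J_\pm}\mu_k$. In the cluster algebra with trivial coefficients $\mathcal{A}(B,x)\subset\mathbb{Q}(x_i\mid i\in J)$ with initial seed $(B,x)$, set $x(0)=x$ and define clusters $x(u)=(x_i(u))_{i\in J}$, $u\in\mathbb{Z}$, by $$\cdots\overset{\mu_-}{\longleftrightarrow}(B,x(0))\overset{\mu_+}{\longleftrightarrow}(-B,x(1))\overset{\mu_-}{\longleftrightarrow}(B,x(2))\overset{\mu_+}{\longleftrightarrow}\cdots$$ ($\mu_+$ between $u$ and $u+1$ for $u$ even, $\mu_-$ for $u$ odd). $\mathcal{A}_T(B,x)$ is the subring of $\mathcal{A}(B,x)$ generated by all $x_i(u)$ ($i\in J,u\in\mathbb{Z}$). *)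

(* Defs.v *)
From HB Require Import structures.
From mathcomp Require Import all_boot all_order all_algebra generic_quotient.
From mathcomp Require Import boolp.
From mathcomp Require Import monalg.
From mathcomp Require Import mpoly.

Set Implicit Arguments.
Unset Strict Implicit.
Unset Printing Implicit Defensive.

Import Order.TTheory GRing.Theory Num.Theory.
Local Open Scope ring_scope.
Local Open Scope quotient_scope.

(* Quotient of a commutative ring R by the ideal generated by a set S.  The
   ideal quotients of ring_quotient require the ideal to be proper (and
   boolean); here 1 may lie in the ideal, and the quotient is a comPzRingType. *)
Section IdealGen.
Variables (R : comNzRingType) (S : R -> Prop).

Inductive ideal_gen : R -> Prop :=
| ideal_gen0 : ideal_gen 0
| ideal_genD c r p : S r -> ideal_gen p -> ideal_gen (c * r + p).

Lemma ideal_gen_add p q : ideal_gen p -> ideal_gen q -> ideal_gen (p + q).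
Proof.
by elim=> [|c r p' Sr _ IH] Iq; rewrite ?add0r // -addrA; apply/ideal_genD/IH.
Qed.

Lemma ideal_gen_mul c p : ideal_gen p -> ideal_gen (c * p).
Proof.
elim=> [|d r q Sr _ IH]; first by rewrite mulr0; apply: ideal_gen0.
by rewrite mulrDr mulrA; apply: ideal_genD.
Qed.

Lemma ideal_gen_opp p : ideal_gen p -> ideal_gen (- p).
Proof. by rewrite -mulN1r; apply: ideal_gen_mul. Qed.

Definition ideal_eqv (x y : R) : bool := `[< ideal_gen (x - y) >].

Lemma ideal_eqv_class : equiv_class_of ideal_eqv.
Proof.
split=> [x|x y|y x z]; rewrite /ideal_eqv.
- by apply/asboolP; rewrite subrr; apply: ideal_gen0.
- by apply/asboolP/asboolP => /ideal_gen_opp; rewrite opprB.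
- move=> /asboolP Ixy /asboolP Iyz; apply/asboolP.
  by rewrite -[x](addrNK y) -addrA; apply: ideal_gen_add.
Qed.

Canonical ideal_eqv_rel := EquivRelPack ideal_eqv_class.
Canonical ideal_eqv_enc := defaultEncModRel ideal_eqv.

Definition ring_mod := {eq_quot ideal_eqv}.

HB.instance Definition _ : EqQuotient R ideal_eqv ring_mod :=
  EqQuotient.on ring_mod.
HB.instance Definition _ := Choice.on ring_mod.

Lemma ring_modP x y : reflect (ideal_gen (x - y)) (x == y %[mod ring_mod]).
Proof. by rewrite piE; apply: asboolP. Qed.

Let ideal_repr x : ideal_gen (x - repr (\pi_ring_mod x)).
Proof. by apply/ring_modP; rewrite reprK. Qed.

Definition ring_mod_zero : ring_mod := lift_cst ring_mod 0.
Definition ring_mod_one : ring_mod := lift_cst ring_mod 1.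
Definition ring_mod_add := lift_op2 ring_mod +%R.
Definition ring_mod_opp := lift_op1 ring_mod -%R.
Definition ring_mod_mul := lift_op2 ring_mod *%R.

Canonical pi_ring_mod_zero := PiConst ring_mod_zero.
Canonical pi_ring_mod_one := PiConst ring_mod_one.

Lemma ring_mod_opp_pi : {morph \pi_ring_mod : x / - x >-> ring_mod_opp x}.
Proof.
move=> x; unlock ring_mod_opp; apply/eqP/ring_modP.
by rewrite -opprD; apply: ideal_gen_opp.
Qed.
Canonical pi_ring_mod_opp := PiMorph1 ring_mod_opp_pi.

Lemma ring_mod_add_pi : {morph \pi_ring_mod : x y / x + y >-> ring_mod_add x y}.
Proof.
move=> x y; unlock ring_mod_add; apply/eqP/ring_modP.
by rewrite opprD addrACA; apply: ideal_gen_add.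
Qed.
Canonical pi_ring_mod_add := PiMorph2 ring_mod_add_pi.

Lemma ring_mod_mul_pi : {morph \pi_ring_mod : x y / x * y >-> ring_mod_mul x y}.
Proof.
move=> x y; unlock ring_mod_mul; apply/eqP/ring_modP.
rewrite -[_ * _](addrNK (x * repr (\pi_ring_mod y))) -mulrBr -addrA -mulrBl.
apply: ideal_gen_add; first exact: ideal_gen_mul.
by rewrite mulrC; apply: ideal_gen_mul.
Qed.
Canonical pi_ring_mod_mul := PiMorph2 ring_mod_mul_pi.

Let addA : associative ring_mod_add.
Proof. by move=> x y z; rewrite -[x]reprK -[y]reprK -[z]reprK !piE addrA. Qed.
Let addC : commutative ring_mod_add.
Proof. by move=> x y; rewrite -[x]reprK -[y]reprK !piE addrC. Qed.
Let add0 : left_id ring_mod_zero ring_mod_add.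
Proof. by move=> x; rewrite -[x]reprK !piE add0r. Qed.
Let addN : left_inverse ring_mod_zero ring_mod_opp ring_mod_add.
Proof. by move=> x; rewrite -[x]reprK !piE addNr. Qed.

HB.instance Definition _ := GRing.isZmodule.Build ring_mod addA addC add0 addN.

Let mulA : associative ring_mod_mul.
Proof. by move=> x y z; rewrite -[x]reprK -[y]reprK -[z]reprK !piE mulrA. Qed.
Let mulC : commutative ring_mod_mul.
Proof. by move=> x y; rewrite -[x]reprK -[y]reprK !piE mulrC. Qed.
Let mul1 : left_id ring_mod_one ring_mod_mul.
Proof. by move=> x; rewrite -[x]reprK !piE mul1r. Qed.
Let mulD : left_distributive ring_mod_mul ring_mod_add.
Proof.
by move=> x y z; rewrite -[x]reprK -[y]reprK -[z]reprK !piE mulrDl.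
Qed.

HB.instance Definition _ :=
  GRing.Zmodule_isComPzRing.Build ring_mod mulA mulC mul1 mulD.

Lemma pi_ring_mod_is_zmod_morphism : zmod_morphism \pi_ring_mod.
Proof. by move=> x y; rewrite ring_mod_add_pi ring_mod_opp_pi. Qed.

Lemma pi_ring_mod_is_monoid_morphism : monoid_morphism \pi_ring_mod.
Proof.
by split=> [|x y]; [rewrite [RHS]piE | rewrite ring_mod_mul_pi].
Qed.

HB.instance Definition _ :=
  GRing.isZmodMorphism.Build R ring_mod \pi_ring_mod
    pi_ring_mod_is_zmod_morphism.
HB.instance Definition _ :=
  GRing.isMonoidMorphism.Build R ring_mod \pi_ring_mod
    pi_ring_mod_is_monoid_morphism.

End IdealGen.

Section SubringGen.
Variables (R : pzRingType) (G : R -> Prop).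

Inductive in_subring : R -> Prop :=
| in_subring_gen x : G x -> in_subring x
| in_subring1 : in_subring 1
| in_subringB x y : in_subring x -> in_subring y -> in_subring (x - y)
| in_subringM x y : in_subring x -> in_subring y -> in_subring (x * y).

Definition subring_pred : {pred R} := fun x => `[< in_subring x >].

Lemma subring_pred_closed : subring_closed subring_pred.
Proof.
split=> [|x y /asboolP Sx /asboolP Sy|x y /asboolP Sx /asboolP Sy].
- exact/asboolP/in_subring1.
- exact/asboolP/in_subringB.
- exact/asboolP/in_subringM.
Qed.

HB.instance Definition _ :=
  GRing.isSubringClosed.Build R subring_pred subring_pred_closed.

(* The subring of R generated by G, as a ring on its own. *)
Record subring_gen := SubringGen {
  subring_val : R; _ : subring_val \in subring_pred }.

HB.instance Definition _ := [isSub for subring_val].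
HB.instance Definition _ := [Choice of subring_gen by <:].
HB.instance Definition _ :=
  GRing.SubChoice_isSubPzRing.Build R subring_pred subring_gen
    subring_pred_closed.

End SubringGen.

Definition gen_cartan (I : finType) (C : I -> I -> int) : Prop :=
  [/\ forall i, C i i = 2,
      forall i j, i != j -> C i j <= 0 &
      forall i j, C i j = 0 <-> C j i = 0].

Definition simply_laced (I : finType) (C : I -> I -> int) : Prop :=
  forall i j, i != j -> C i j = 0 \/ C i j = -1.

(* A decomposition I = I_+ + I_- is given by Ip = I_+, with I_- = ~: Ip. *)
Definition bipartite (I : finType) (C : I -> I -> int) (Ip : {set I}) : Prop :=
  forall i j, C i j < 0 ->
    (i \in Ip) && (j \in ~: Ip) || (i \in ~: Ip) && (j \in Ip).

Definition part_sign (I : finType) (Ip : {set I}) (a : I) : int :=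
  if a \in Ip then 1 else -1.

(* The index m = 1, ..., l - 1 is encoded by the ordinal m - 1 : 'I_l.-1. *)
Section TSystem.
Variables (I : finType) (C : I -> I -> int) (l : nat).

Definition Tindex := (I * 'I_l.-1 * int)%type.

(* inl g stands for T_g, inr g for its inverse. *)
Definition Tletter := (Tindex + Tindex)%type.

Definition Tfree := {malg int[{cmonom Tletter}]}.
HB.instance Definition _ := GRing.ComNzRing.on Tfree.

Definition Tvar (g : Tletter) : Tfree := << ucm g >>.

(* T^(a)_m(u) for 0 <= m <= l, including T^(a)_0(u) = T^(a)_l(u) = 1. *)
Definition Tgen (a : I) (m : nat) (u : int) : Tfree :=
  if m is k.+1 then
    if insub k is Some j then Tvar (inl (a, j, u)) else 1
  else 1.

Inductive Trel : Tfree -> Prop :=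
| Trel_inv (g : Tindex) : Trel (Tvar (inl g) * Tvar (inr g) - 1)
| Trel_T (a : I) (m : nat) (u : int) : (0 < m < l)%N ->
    Trel (Tgen a m (u - 1) * Tgen a m (u + 1)
          - (Tgen a m.-1 u * Tgen a m.+1 u + \prod_(b | C b a < 0) Tgen b m u)).

Definition Tring := ring_mod Trel.
HB.instance Definition _ := GRing.ComPzRing.on Tring.

Definition Tproj : Tfree -> Tring := \pi_(ring_mod Trel).
HB.instance Definition _ := GRing.isZmodMorphism.Build Tfree Tring Tproj
  (pi_ring_mod_is_zmod_morphism Trel).
HB.instance Definition _ := GRing.isMonoidMorphism.Build Tfree Tring Tproj
  (pi_ring_mod_is_monoid_morphism Trel).

Definition T (a : I) (m : nat) (u : int) : Tring := Tproj (Tgen a m u).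

(* These generators lie in T^o_l(C), the subring generated by all T^(a)_m(u),
   so the subring they generate in T^o_l(C) and in T_l(C) is the same. *)
Definition Tcirc_gens (Ip : {set I}) (eps : int) (t : Tring) : Prop :=
  exists (a : I) (m : nat) (u : int),
    [/\ (0 < m < l)%N, part_sign Ip a * (-1) ^ (m%:Z + 1 + u) = eps
      & t = T a m u].

Definition Tcirc (Ip : {set I}) (eps : int) := subring_gen (Tcirc_gens Ip eps).

End TSystem.

Section Cluster.
Variable (J : finType).

Definition cfield := {fraction (mpoly #|J| rat)}.
HB.instance Definition _ := GRing.Field.on cfield.

Definition cvar (i : J) : cfield := tofrac 'X_(enum_rank i).

Definition seed := ((J -> J -> int) * (J -> cfield))%type.

(* The numerator under %/ 2 is always even. *)
Definition mutate_mx (k : J) (B : J -> J -> int) : J -> J -> int :=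
  fun i j => if (i == k) || (j == k) then - B i j
             else B i j + ((`|B i k| * B k j + B i k * `|B k j|) %/ 2)%Z.

Definition mutate (k : J) (s : seed) : seed :=
  (mutate_mx k s.1,
   fun i => if i == k then
       (s.2 k)^-1 * (\prod_(j | 0 < s.1 j k) s.2 j ^ s.1 j k
                     + \prod_(j | s.1 j k < 0) s.2 j ^ (- s.1 j k))
     else s.2 i).

(* Composite of the mutations at the elements of K; when B_kk' = 0 for all
   k, k' in K, these commute and the order is irrelevant. *)
Definition mutate_set (K : {set J}) (s : seed) : seed :=
  foldr mutate s (enum K).

(* n steps from s: mutate along K, then K', then K, ... *)
Fixpoint alternate (K K' : {set J}) (n : nat) (s : seed) : seed :=
  if n is n'.+1 then
    mutate_set (if odd n' then K' else K) (alternate K K' n' s)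
  else s.

Variables (B : J -> J -> int) (Jp : {set J}).

(* mu_+ joins u and u + 1 for u even, mu_- for u odd.  As mu_+ and mu_- are
   involutive along this sequence, negative times are reached from u = 0 by
   mutating along mu_-, mu_+, mu_-, ... *)
Definition seed_at (u : int) : seed :=
  match u with
  | Posz n => alternate Jp (~: Jp) n (B, cvar)
  | Negz n => alternate (~: Jp) Jp n.+1 (B, cvar)
  end.

Definition cluster_at (u : int) (i : J) : cfield := (seed_at u).2 i.

(* The x_i(u) are cluster variables, so the subring they generate in A(B, x)
   is the subring they generate in the ambient field. *)
Definition AT :=
  subring_gen (fun y : cfield => exists (i : J) (u : int), y = cluster_at u i).

End Cluster.

Definition Bmat (I : finType) (C : I -> I -> int) (Ip : {set I}) (i j : I)
    : int :=
  if (i \in Ip) && (j \in ~: Ip) then - C i j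
  else if (i \in ~: Ip) && (j \in Ip) then C i j
  else 0.

Section SquareProduct.
Variables (I I' : finType) (C : I -> I -> int) (C' : I' -> I' -> int).
Variables (Ip : {set I}) (Ip' : {set I'}).

Let pp (p : I * I') := (p.1 \in Ip) && (p.2 \in Ip').
Let pm (p : I * I') := (p.1 \in Ip) && (p.2 \in ~: Ip').
Let mp (p : I * I') := (p.1 \in ~: Ip) && (p.2 \in Ip').
Let mm (p : I * I') := (p.1 \in ~: Ip) && (p.2 \in ~: Ip').

Definition square_prod (i j : I * I') : int :=
  if mp i && pp j || pm i && mm j then - C i.1 j.1 * (i.2 == j.2)%:R
  else if pp i && mp j || mm i && pm j then C i.1 j.1 * (i.2 == j.2)%:R
  else if pp i && pm j || mm i && mp j then - (i.1 == j.1)%:R * C' i.2 j.2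
  else if pm i && pp j || mp i && mm j then (i.1 == j.1)%:R * C' i.2 j.2
  else 0.

Definition square_plus : {set I * I'} := [set p | pp p || mm p].

End SquareProduct.

Definition cartanA (n : nat) (i j : 'I_n) : int :=
  if i == j then 2 else if (i.+1 == j) || (j.+1 == i) then -1 else 0.

(* {1, 3, ...} under the encoding of m = 1, ..., n as m - 1 : 'I_n. *)
Definition cartanA_plus (n : nat) : {set 'I_n} := [set i : 'I_n | ~~ odd i].

(* Main.v *)
Require Import Defs.
From HB Require Import structures.
From mathcomp Require Import all_boot all_order all_algebra.
From mathcomp Require Import generic_quotient boolp finmap.
From mathcomp Require Import monalg.
From mathcomp Require Import mpoly.
From mathcomp Require Import zify ring.

(** Both cases are instances of one statement about a bipartite belt: a matrix
    B whose nonzero entries join the two parts of J, and which mutation along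
    either part turns into -B ([mutate_set_belt]).  On such a belt the clusters
    satisfy
      x_k(u - 1) x_k(u + 1) = P_k(x(u))   for every k and every u,
    where P_k is the exchange polynomial of B at k ([cluster_exchange]).
    Indeed x_k changes only in one of the two steps around u, the neighbours
    of k do not change in that step, and P_k does not see the sign of B.  For
    B(C) and for the square product, P_k is the right-hand side of the T-system
    ([Bmat_exchange], [square_exchange]).

    Hence T^(a)_m(u) |-> x_am(u), for all a, m and u and not only those of the
    chosen parity, respects the relations.  It extends to the inverses of the
    generators because the cluster variables are subtraction-free, hence
    nonzero ([subfree_cluster]).  This gives a morphism f from the whole
    T-system ring to the field of rational functions ([T_realisation]), which
    is then restricted to the subring of one parity.

    The image is all of A_T: if (i, u) has the wrong parity, then x_i(u) equals
    x_i(u - 1) or x_i(u + 1), depending on which of the two steps fixes i, and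
    that time has the right parity.

    For injectivity, take one initial T per vertex, at two consecutive times;
    f sends these to the independent variables x_i.  Every T of the chosen
    parity is a quotient E(p) / E(q) of polynomials in the initial ones with
    E(q) invertible: by the T-system, the T at u + 1 is the right-hand side at
    u divided by the T at u - 1, and that T is a unit of the ring
    ([good_is_quot]).  So is then every element y of the subring, and
    E(q) y = E(p) with f(y) = 0 gives f(E(p)) = 0, p = 0 and y = 0
    ([is_quot_inj]). *)

Set Implicit Arguments.
Unset Strict Implicit.
Unset Printing Implicit Defensive.

Import Order.TTheory GRing.Theory Num.Theory.
Local Open Scope ring_scope.
Local Open Scope quotient_scope.

(** * Subtraction-free elements *)

Section SubtractionFree.
Variable J : finType.

Definition at_one : {rmorphism mpoly.mpoly #|J| rat -> rat} :=
  mpoly.meval (fun=> 1).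

(** Elements that are visibly nonzero, in a class closed under the operations
    of an exchange relation, division included.  Being positive at the single
    point (1, ..., 1) is such a property. *)
Definition subfree (y : cfield J) : Prop :=
  exists p q : mpoly.mpoly #|J| rat,
    [/\ 0 < at_one p, 0 < at_one q & y = tofrac p / tofrac q].

Lemma tofrac_at_one_neq0 (p : mpoly.mpoly #|J| rat) :
  0 < at_one p -> tofrac p != 0.
Proof.
move=> p0; rewrite tofrac_eq0; apply: contraTneq p0 => ->.
by rewrite raddf0 ltxx.
Qed.

Lemma subfree_neq0 y : subfree y -> y != 0.
Proof.
by case=> p [q [p0 q0 ->]]; rewrite mulf_neq0 ?invr_neq0 ?tofrac_at_one_neq0.
Qed.

Lemma subfree_cvar i : subfree (cvar i).
Proof.
exists (mpoly.mpolyX _ (mpoly.mnm1 (enum_rank i))), 1; split.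
- by rewrite /= mpoly.mevalXU.
- by rewrite rmorph1.
- by rewrite tofrac1 divr1.
Qed.

Lemma subfree1 : subfree 1.
Proof. by exists 1, 1; rewrite rmorph1 tofrac1 divr1. Qed.

Lemma subfreeD y z : subfree y -> subfree z -> subfree (y + z).
Proof.
move=> [p [q [p0 q0 ->]]] [p' [q' [p'0 q'0 ->]]].
exists (p * q' + p' * q), (q * q'); split.
- by rewrite rmorphD !rmorphM addr_gt0 ?mulr_gt0.
- by rewrite rmorphM mulr_gt0.
- by rewrite addf_div ?tofrac_at_one_neq0 // tofracD !tofracM.
Qed.

Lemma subfreeM y z : subfree y -> subfree z -> subfree (y * z).
Proof.
move=> [p [q [p0 q0 ->]]] [p' [q' [p'0 q'0 ->]]].
exists (p * p'), (q * q'); split.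
- by rewrite rmorphM mulr_gt0.
- by rewrite rmorphM mulr_gt0.
- by rewrite mulf_div !tofracM.
Qed.

Lemma subfreeV y : subfree y -> subfree y^-1.
Proof.
by move=> [p [q [p0 q0 ->]]]; exists q, p; split=> //; rewrite invf_div.
Qed.

Lemma subfreeXz y n : subfree y -> subfree (y ^ n).
Proof.
move=> Sy; have SX k : subfree (y ^+ k).
  by elim: k => [|k IH]; [exact: subfree1 | rewrite exprS; apply: subfreeM].
by case: n => k; [exact: SX | rewrite NegzE -exprnN; apply: subfreeV].
Qed.

Lemma subfree_prod (A : Type) (r : seq A) (P : pred A) (y : A -> cfield J) :
  (forall a, subfree (y a)) -> subfree (\prod_(a <- r | P a) y a).
Proof.
by move=> Sy; apply: big_ind => //; [exact: subfree1 | exact: subfreeM].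
Qed.

End SubtractionFree.

(** * Mutation along a set of pairwise disconnected vertices *)

Section Mutation.
Variable J : finType.
Implicit Types (B : J -> J -> int) (x : J -> cfield J) (s : seed J).

Definition exchange_poly B x (k : J) : cfield J :=
  \prod_(j | 0 < B j k) x j ^ B j k + \prod_(j | B j k < 0) x j ^ (- B j k).

Lemma eq_exchange_poly B B' x x' k :
    (forall j, B j k = B' j k) -> (forall j, B j k != 0 -> x j = x' j) ->
  exchange_poly B x k = exchange_poly B' x' k.
Proof.
move=> eqB eqx; rewrite /exchange_poly; congr (_ + _).
  apply: eq_big => [j|j Bj]; first by rewrite eqB.
  by rewrite -eqB eqx // gt_eqF.
apply: eq_big => [j|j Bj]; first by rewrite eqB.
by rewrite -eqB eqx // lt_eqF.
Qed.

(** The two monomials trade places, so that exchange relations read the same on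
    both sides of a step that negates the matrix. *)
Lemma exchange_polyN B x k :
  exchange_poly (fun i j => - B i j) x k = exchange_poly B x k.
Proof.
rewrite /exchange_poly addrC; congr (_ + _); apply: eq_big => [j|j _].
- by rewrite oppr_lt0.
- by rewrite opprK.
- by rewrite oppr_gt0.
- by [].
Qed.

Lemma subfree_exchange_poly B x k :
  (forall i, subfree (x i)) -> subfree (exchange_poly B x k).
Proof.
by move=> Sx; apply: subfreeD; apply: subfree_prod => j; apply: subfreeXz.
Qed.

(** Twice the change of the entry [(i, j)] under mutation at [k]: the signed
    number of paths from [i] to [j] through [k], counted twice.  Leaving out the
    division by 2 makes sums over [k] and changes of sign of [B] easy to
    handle. *)
Definition path_weight B (k i j : J) : int :=
  `|B i k| * B k j + B i k * `|B k j|.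

Lemma path_weight_even B k i j :
  (path_weight B k i j %/ 2)%Z * 2 = path_weight B k i j.
Proof.
apply/eqP; rewrite -dvdz_eq; apply/dvdzP; rewrite /path_weight.
case: (lerP 0 (B i k)); case: (lerP 0 (B k j)) => ? ?;
  [exists (B i k * B k j) | exists 0 | exists 0 | exists (- (B i k * B k j))];
  lia.
Qed.

Lemma path_weight0l B k i j : B i k = 0 -> path_weight B k i j = 0.
Proof. by rewrite /path_weight => ->; rewrite normr0 !mul0r. Qed.

Lemma path_weight0r B k i j : B k j = 0 -> path_weight B k i j = 0.
Proof. by rewrite /path_weight => ->; rewrite normr0 !mulr0. Qed.

(** Between vertices of [ks] all entries vanish, so a mutation at one of them
    changes neither the row nor the column nor the neighbouring variables of
    another one: each mutation acts as if it were performed first. *)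
Lemma foldr_mutate s (ks : seq J) :
    uniq ks -> {in ks &, forall i j, s.1 i j = 0} ->
  (forall i j, (foldr (@mutate J) s ks).1 i j =
     if (i \in ks) || (j \in ks) then - s.1 i j
     else s.1 i j + \sum_(k <- ks) (path_weight s.1 k i j %/ 2)%Z) /\
  (forall i, (foldr (@mutate J) s ks).2 i =
     if i \in ks then (s.2 i)^-1 * exchange_poly s.1 s.2 i else s.2 i).
Proof.
elim: ks => [_ _|k ks IH /= /andP[k_ks uks] s0].
  by split=> // i j /=; rewrite big_nil addr0.
have s0k i j : i \in ks -> j \in ks -> s.1 i j = 0.
  by move=> iks jks; apply: s0; rewrite inE ?iks ?jks orbT.
have {IH} [] := IH uks s0k; set s' := foldr _ _ _ => mxE clE.
have s0l i : i \in ks -> s.1 i k = 0.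
  by move=> iks; apply: s0; rewrite !inE ?eqxx ?iks ?orbT.
have s0r i : i \in ks -> s.1 k i = 0.
  by move=> iks; apply: s0; rewrite !inE ?eqxx ?iks ?orbT.
have colE i : s'.1 i k = s.1 i k.
  rewrite mxE (negPf k_ks) orbF; case: ifP => [/s0l->|_].
    by rewrite oppr0.
  by rewrite big_seq big1 ?addr0 // => k' /s0l /path_weight0r ->.
have rowE j : s'.1 k j = s.1 k j.
  rewrite mxE (negPf k_ks) /=; case: ifP => [/s0r->|_]; first by rewrite oppr0.
  by rewrite big_seq big1 ?addr0 // => k' /s0r /path_weight0l ->.
split=> [i j|i] /=.
  rewrite /mutate_mx -/(path_weight s'.1 k i j) !inE.
  case: (eqVneq i k) => [->|ik] /=; first by rewrite rowE.
  case: (eqVneq j k) => [->|jk] /=; first by rewrite orbT colE.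
  rewrite /path_weight colE rowE -/(path_weight s.1 k i j) mxE.
  case: (boolP (i \in ks)) => [/s0l iks|_].
    by rewrite path_weight0l ?addr0.
  case: (boolP (j \in ks)) => [/s0r jks|_]; rewrite /= ?orbT ?orbF.
    by rewrite path_weight0r ?addr0.
  by rewrite big_cons -addrA; congr (_ + _); rewrite addrC.
rewrite inE; case: eqVneq => [->|_] /=; last exact: clE.
rewrite clE (negPf k_ks); congr (_ * _).
rewrite -/(exchange_poly s'.1 s'.2 k).
apply: eq_exchange_poly => // j; rewrite colE clE.
by case: ifP => // /s0l ->; rewrite eqxx.
Qed.

End Mutation.

(** * The bipartite belt *)

Section Belt.
Variables (J : finType) (B : J -> J -> int) (Jp : {set J}).

Hypothesis bipB : forall i j, (i \in Jp) = (j \in Jp) -> B i j = 0.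
Hypothesis balB : forall i j, \sum_k path_weight B k i j = 0.

(** Rows and columns in [K] are negated; an entry off [K] joins two vertices of
    the same part, hence is 0, and stays 0 by cancellation. *)
Lemma mutate_set_belt (b : bool) (n : nat) (s : seed J) (K : {set J}) :
    K = (if b then Jp else ~: Jp) ->
    (forall i j, s.1 i j = (-1) ^+ n * B i j) ->
  (forall i j, (mutate_set K s).1 i j = (-1) ^+ n.+1 * B i j) /\
  (forall i, (mutate_set K s).2 i =
     if i \in K then (s.2 i)^-1 * exchange_poly B s.2 i else s.2 i).
Proof.
move=> KE sE.
have inK i : (i \in K) = ((i \in Jp) == b).
  by rewrite KE; case: b {KE}; rewrite ?inE; case: (i \in Jp).
have inKJ i j : (i \in K) = (j \in K) -> (i \in Jp) = (j \in Jp).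
  by rewrite !inK; case: (i \in Jp); case: (j \in Jp); case: b {inK KE}.
have pwE k i j : path_weight s.1 k i j = (-1) ^+ n * path_weight B k i j.
  by rewrite /path_weight !sE !normrM !normrX normrN1 expr1n; ring.
have [] := @foldr_mutate _ s (enum K) (enum_uniq _).
  move=> i j; rewrite !mem_enum => iK jK.
  by rewrite sE bipB ?mulr0 //; apply: inKJ; rewrite iK jK.
rewrite -/(mutate_set K s) => mxE clE; split=> [i j|i].
  rewrite mxE !mem_enum sE exprS mulN1r mulNr; case: ifPn => // /norP[iK jK].
  have ij : (i \in K) = (j \in K) by rewrite (negPf iK) (negPf jK).
  rewrite (bipB (inKJ _ _ ij)) mulr0 oppr0 add0r.
  have two0 : (2 : int) != 0 by [].
  apply: (mulIf two0); rewrite mul0r mulr_suml.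
  under eq_bigr do rewrite path_weight_even pwE.
  rewrite -mulr_sumr big_enum /=.
  have := balB i j; rewrite (bigID (mem K)) /= [X in _ + X]big1 => [|k kK].
    by rewrite addr0 => ->; rewrite mulr0.
  by apply: path_weight0l; apply/bipB/inKJ; rewrite (negPf iK) (negPf kK).
rewrite clE mem_enum; case: ifP => // iK; congr (_ * _).
have [nE|nE] : (-1) ^+ n = 1 :> int \/ (-1) ^+ n = -1 :> int.
  by rewrite -signr_odd; case: odd; [right | left].
- by apply: eq_exchange_poly => // j; rewrite sE nE mul1r.
- rewrite -[RHS]exchange_polyN.
  by apply: eq_exchange_poly => // j; rewrite sE nE mulN1r.
Qed.

Lemma alternate_mx b n i j :
  (alternate (if b then Jp else ~: Jp) (if b then ~: Jp else Jp) n
     (B, @cvar J)).1 i j = (-1) ^+ n * B i j.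
Proof.
elim: n i j => [|n IH] i j; first by rewrite mul1r.
have [mxE _] := @mutate_set_belt (b (+) odd n) n _ _ erefl IH.
by rewrite -mxE /=; case: b {mxE IH}; case: odd.
Qed.

Lemma alternate_cl b n i :
  let s := alternate (if b then Jp else ~: Jp) (if b then ~: Jp else Jp) in
  (s n.+1 (B, @cvar J)).2 i =
    let x := (s n (B, @cvar J)).2 in
    if (i \in Jp) == (b (+) odd n) then (x i)^-1 * exchange_poly B x i else x i.
Proof.
move=> s; have [_ clE] :=
  @mutate_set_belt (b (+) odd n) n _ _ erefl (alternate_mx b n).
have -> : ((i \in Jp) == (b (+) odd n)) =
    (i \in if b (+) odd n then Jp else ~: Jp).
  by case: (b (+) odd n); rewrite ?inE; case: (i \in Jp).
rewrite /= -clE /s /=.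
by case: b {s clE}; case: odd.
Qed.

Let x := cluster_at B Jp.

Lemma clusterS n i :
  x n.+1 i = if (i \in Jp) == ~~ odd n
             then (x n i)^-1 * exchange_poly B (x n) i else x n i.
Proof. exact: (alternate_cl true). Qed.

Lemma cluster_pred n i :
  x (Negz n) i = if (i \in Jp) == odd n
    then (x (- n%:Z) i)^-1 * exchange_poly B (x (- n%:Z)) i else x (- n%:Z) i.
Proof.
have -> : x (- n%:Z) =
    (alternate (~: Jp) Jp n (B, @cvar J)).2 by case: n.
exact: (alternate_cl false).
Qed.

Lemma subfree_cluster u i : subfree (x u i).
Proof.
have Hm y b k : (forall j, subfree (y j)) ->
    subfree (if b then (y k)^-1 * exchange_poly B y k else y k).
  move=> Sy; case: b => //; apply: subfreeM; first exact: subfreeV.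
  exact: subfree_exchange_poly.
have Hp (n : nat) j : subfree (x n j).
  elim: n j => [|n IH] j; first exact: subfree_cvar.
  by rewrite clusterS; apply: Hm.
have Hn (n : nat) j : subfree (x (- n%:Z) j).
  elim: n j => [|n IH] j; first exact: subfree_cvar.
  by rewrite -NegzE cluster_pred; apply: Hm.
by case: u => n; rewrite ?NegzE.
Qed.

Lemma cluster_neq0 u i : x u i != 0.
Proof. exact/subfree_neq0/subfree_cluster. Qed.

(** One step of the belt, in a form that does not distinguish the two
    directions in which the seeds are generated: a step backwards in time is an
    exchange relation forwards, because the neighbours of a mutated vertex are
    fixed. *)
Lemma cluster_step u i :
  if (i \in Jp) == ~~ odd (absz u)
  then x u i * x (u + 1) i = exchange_poly B (x u) i
  else x (u + 1) i = x u i.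
Proof.
case: u => n.
  rewrite -PoszD addn1 clusterS /=; case: ifP => [->|-> //].
  by rewrite mulVKf ?cluster_neq0.
have -> : Negz n + 1 = - n%:Z by lia.
have -> : ~~ odd (absz (Negz n)) = odd n by lia.
rewrite cluster_pred; case: ifP => [iE|-> //]; rewrite iE.
rewrite mulrC mulVKf ?cluster_neq0 //.
apply: eq_exchange_poly => // j Bji.
rewrite cluster_pred ifN //; apply: contra_neqN Bji => jE.
by apply: bipB; rewrite (eqP iE) (eqP jE).
Qed.

(** Whichever of the two steps around [u] fixes [i], the other one is the
    exchange relation. *)
Lemma cluster_exchange u i :
  x (u - 1) i * x (u + 1) i = exchange_poly B (x u) i.
Proof.
have := cluster_step u i; have := cluster_step (u - 1) i.
have -> : u - 1 + 1 = u by lia.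
have -> : ~~ odd (absz (u - 1)) = odd (absz u) by lia.
case: eqVneq => iE.
  rewrite ifN; last by rewrite iE; case: odd.
  move=> uE ->; rewrite uE; apply: eq_exchange_poly => // j Bji.
  have := cluster_step (u - 1) j.
  have -> : u - 1 + 1 = u by lia.
  have -> : ~~ odd (absz (u - 1)) = odd (absz u) by lia.
  rewrite ifN => [->//|]; apply: contra_neqN Bji => /eqP jE.
  by apply: bipB; rewrite iE.
move=> <-; rewrite ifT //.
by move: iE; case: (i \in Jp); case: odd.
Qed.

End Belt.

(** * Rings given by generators and relations *)

Section RingMod.
Variables (R : comNzRingType) (S : R -> Prop) (A : comPzRingType).

Lemma ring_mod_lift (f : {rmorphism R -> A}) :
    (forall r, S r -> f r = 0) ->
  exists g : {rmorphism ring_mod S -> A},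
    forall r, g (\pi_(ring_mod S) r) = f r.
Proof.
move=> fS.
have fI r : ideal_gen S r -> f r = 0.
  elim=> [|c s p Ss _ IH]; first by rewrite rmorph0.
  by rewrite rmorphD rmorphM (fS _ Ss) mulr0 add0r.
pose g (t : ring_mod S) := f (repr t).
have gE r : g (\pi_(ring_mod S) r) = f r.
  apply/eqP; rewrite -subr_eq0 -rmorphB; apply/eqP/fI.
  by apply/ring_modP; rewrite reprK.
have gZ : zmod_morphism g.
  move=> s t; rewrite -[s]reprK -[t]reprK.
  by rewrite -pi_ring_mod_is_zmod_morphism !gE rmorphB.
have gM : monoid_morphism g.
  have [pi1 piM] := pi_ring_mod_is_monoid_morphism S.
  split=> [|s t]; first by rewrite -pi1 gE rmorph1.
  by rewrite -[s]reprK -[t]reprK -piM !gE rmorphM.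
pose gZm := GRing.isZmodMorphism.Build _ _ g gZ.
pose gMm := GRing.isMonoidMorphism.Build _ _ g gM.
pose gm : {rmorphism ring_mod S -> A} := HB.pack g gZm gMm.
by exists gm.
Qed.

End RingMod.

Section FreeLift.
Variables (K : choiceType) (A : comNzRingType) (v : K -> A).

Definition monom_eval (m : {cmonom K}) : A :=
  \prod_(k <- finsupp m) v k ^+ m k.

Lemma monom_evalE (d : {fset K}) (m : {cmonom K}) :
  fsubset (finsupp m) d -> monom_eval m = \prod_(k <- d) v k ^+ m k.
Proof.
move=> md; rewrite /monom_eval (big_fset_incl _ md) // => k _ km.
by rewrite fsfun_dflt ?expr0.
Qed.

Lemma monom_eval_mmorphism : mmorphism monom_eval.
Proof.
split=> [m m' /=|]; last first.
  by rewrite /monom_eval big1 // => k _; rewrite cm1 expr0.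
pose d := fsetU (finsupp m) (finsupp m').
rewrite !(@monom_evalE d) ?mdomD ?fsubsetUl ?fsubsetUr ?fsubset_refl //.
by rewrite -big_split; apply: eq_bigr => k _; rewrite cmM exprD.
Qed.

HB.instance Definition _ :=
  isMultiplicative.Build {cmonom K} A monom_eval monom_eval_mmorphism.

Lemma free_lift :
  exists f : {rmorphism {malg int[{cmonom K}]} -> A},
    forall k, f << ucm k >> = v k.
Proof.
exists (monalg.mmap (intr : int -> A) monom_eval) => k.
rewrite /= monalg.mmapU mul1r /monom_eval mdomU big_seq_fset1.
by rewrite cmUU.
Qed.

End FreeLift.

Section SubringMorphism.
Variables (R S : pzRingType) (f : {rmorphism R -> S}).
Variables (G : R -> Prop) (H : S -> Prop).

Lemma subring_gen_iso :
    (forall x, G x -> in_subring H (f x)) ->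
    (forall y, H y -> exists2 x, in_subring G x & f x = y) ->
    (forall x, in_subring G x -> f x = 0 -> x = 0) ->
  exists2 g : {rmorphism subring_gen G -> subring_gen H},
    bijective g & forall t, val (g t) = f (val t).
Proof.
move=> fG fH f0.
have fS x : in_subring G x -> in_subring H (f x).
  elim=> [y /fG //||y z _ IHy _ IHz|y z _ IHy _ IHz].
  - by rewrite rmorph1; apply: in_subring1.
  - by rewrite rmorphB; apply: in_subringB.
  - by rewrite rmorphM; apply: in_subringM.
have fSb (t : subring_gen G) : f (val t) \in subring_pred H.
  by apply/asboolP/fS; case: t => t /= /asboolP.
pose g t : subring_gen H := SubringGen (fSb t).
have gZ : zmod_morphism g by move=> s t; apply: val_inj; rewrite /= !rmorphB.
have gM : monoid_morphism g.
  by split=> [|s t]; apply: val_inj; rewrite /= ?rmorph1 ?rmorphM.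
pose gZm := GRing.isZmodMorphism.Build _ _ g gZ.
pose gMm := GRing.isMonoidMorphism.Build _ _ g gM.
pose gm : {rmorphism subring_gen G -> subring_gen H} := HB.pack g gZm gMm.
exists gm => //.
have fonto y : in_subring H y -> exists2 x, in_subring G x & f x = y.
  elim=> [z /fH //|
         |z w _ [x Gx <-] _ [x' Gx' <-]|z w _ [x Gx <-] _ [x' Gx' <-]].
  - by exists 1; [exact: in_subring1 | rewrite rmorph1].
  - by exists (x - x'); [exact: in_subringB | rewrite rmorphB].
  - by exists (x * x'); [exact: in_subringM | rewrite rmorphM].
have gonto (y : subring_gen H) : exists t, gm t == y.
  case: y => y yP; have /asboolP/fonto[x Gx fx] := yP.
  have xP : x \in subring_pred G by apply/asboolP.
  by exists (SubringGen xP); apply/eqP/val_inj.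
exists (fun y => xchoose (gonto y)); last first.
  by move=> y; apply/eqP/(xchooseP (gonto y)).
move=> t; have /eqP := xchooseP (gonto (gm t)).
set s := xchoose _ => /(congr1 val) /= fst.
apply/val_inj/eqP; rewrite -subr_eq0; apply/eqP/f0; last first.
  by rewrite rmorphB fst subrr.
by apply: in_subringB; apply/asboolP; [case: s {fst} | case: t {s fst}].
Qed.

End SubringMorphism.

(** * Quotients of polynomials in an initial family *)

Section Fractions.
Variables (P R : comPzRingType) (E : {rmorphism P -> R}).

(** [y = E p / E q] with [E q] invertible.  Asking for the denominator to be a
    unit and to lie in the image of [E] is what makes these elements closed
    under sums, and under division by those of them that are units. *)
Definition is_quot (y : R) : Prop :=
  exists p q r, E q * r = 1 /\ E q * y = E p.

Lemma is_quot_image p : is_quot (E p).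
Proof. by exists p, 1, 1; rewrite rmorph1 !mul1r. Qed.

Lemma is_quot_subring G y :
  (forall z, G z -> is_quot z) -> in_subring G y -> is_quot y.
Proof.
move=> GE; elim=> {y} [y /GE //||y z _ IHy _ IHz|y z _ IHy _ IHz].
- by rewrite -(rmorph1 E); apply: is_quot_image.
- have [[p [q [r [qr qy]]]] [p' [q' [r' [qr' qz]]]]] := (IHy, IHz).
  exists (q' * p - q * p'), (q * q'), (r * r').
  by rewrite rmorphB !rmorphM mulrACA qr qr' mulr1 -qy -qz; split=> //; ring.
- have [[p [q [r [qr qy]]]] [p' [q' [r' [qr' qz]]]]] := (IHy, IHz).
  exists (p * p'), (q * q'), (r * r').
  by rewrite !rmorphM mulrACA qr qr' mulr1 -qy -qz mulrACA.
Qed.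

Lemma is_quot_div z z' y :
  is_quot z -> z * z' = 1 -> is_quot (z * y) -> is_quot y.
Proof.
move=> [p [q [r [qr qz]]]] zz' [p' [q' [r' [qr' qy]]]].
exists (q * p'), (q' * p), (r' * r * z').
rewrite !rmorphM -qz -qy; split; last by ring.
transitivity ((E q * r) * (E q' * r') * (z * z')); first by ring.
by rewrite qr qr' zz' !mulr1.
Qed.

Lemma is_quot_inj (F : pzRingType) (f : {rmorphism R -> F}) y :
  (forall p, f (E p) = 0 -> p = 0) -> is_quot y -> f y = 0 -> y = 0.
Proof.
move=> f0 [p [q [r [qr qy]]]] fy.
have p0 : p = 0 by apply: f0; rewrite -qy rmorphM fy mulr0.
by rewrite -[y]mul1r -qr mulrAC qy p0 rmorph0 mul0r.
Qed.

End Fractions.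

(** * T-systems realised on a bipartite belt *)

Lemma int_ind_both (P : int -> Prop) (c : int) :
  P c -> (forall u, P u -> P (u + 1)) -> (forall u, P u -> P (u - 1)) ->
  forall u, P u.
Proof.
move=> Pc PS Pp u.
have Pn (n : nat) : P (c + n%:Z) /\ P (c - n%:Z).
  elim: n => [|n [IHp IHn]]; first by rewrite oppr0 addr0.
  split; first by have := PS _ IHp; rewrite -addrA -PoszD addn1.
  by have := Pp _ IHn; rewrite -addrA -opprD -PoszD addn1.
have [up|un] := lerP c u.
  have [+ _] := Pn (absz (u - c)).
  by have -> : c + (absz (u - c))%:Z = u by lia.
have [_ +] := Pn (absz (c - u)).
by have -> : c - (absz (c - u))%:Z = u by lia.
Qed.

(* The two shapes of relators of the T-system. *)
Lemma rmorph_inverse (R A : pzRingType) (f : {rmorphism R -> A}) p q :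
  f (p * q - 1) = f p * f q - 1.
Proof. by rewrite rmorphB rmorphM rmorph1. Qed.

Lemma rmorph_exchange (R A : pzRingType) (f : {rmorphism R -> A}) p q s t w :
  f (p * q - (s * t + w)) = f p * f q - (f s * f t + f w).
Proof. by rewrite rmorphB rmorphD !rmorphM. Qed.

Section Realisation.
Variables (I : finType) (C : I -> I -> int) (l : nat) (Ip : {set I}).

Lemma Tgen_ord (a : I) (m : 'I_l.-1) u : Tgen l a m.+1 u = Tvar (inl (a, m, u)).
Proof. by rewrite /Tgen valK. Qed.

Lemma T_inv (g : Tindex I l) :
  Tproj C (Tvar (inl g)) * Tproj C (Tvar (inr g)) = 1.
Proof.
rewrite -rmorphM -(rmorph1 (@Tproj I C l)); apply/eqP/ring_modP.
rewrite -[X in ideal_gen _ X]addr0 -[X in X + 0]mul1r.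
by apply: ideal_genD; [exact: Trel_inv | exact: ideal_gen0].
Qed.

Lemma T_rel (a : I) (m : nat) u : (0 < m < l)%N ->
  T C l a m (u - 1) * T C l a m (u + 1) =
  T C l a m.-1 u * T C l a m.+1 u + \prod_(b | C b a < 0) T C l b m u.
Proof.
move=> ml; rewrite /T -rmorph_prod -!rmorphM -rmorphD; apply/eqP/ring_modP.
rewrite -[X in ideal_gen _ X]addr0 -[X in X + 0]mul1r.
by apply: ideal_genD; [exact: Trel_T | exact: ideal_gen0].
Qed.

Lemma T_ord_inv a (m : 'I_l.-1) u : exists z, T C l a m.+1 u * z = 1.
Proof. by rewrite /T Tgen_ord; eexists; apply: T_inv. Qed.

(** A family [y] in place of the generators T^(a)_m at a fixed time, extended
    by 1 to the boundary values of [m]. *)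
Definition pad (A : pzRingType) (y : I * 'I_l.-1 -> A) (a : I) (m : nat) : A :=
  if m is k.+1 then if insub k is Some j then y (a, j) else 1 else 1.

Variables (J : finType) (B : J -> J -> int) (Jp : {set J}).
(* The relabelling of the pairs (a, m) by the vertices of the belt: the first
   projection for l = 2, the identity otherwise. *)
Variables (h : I * 'I_l.-1 -> J) (h' : J -> I * 'I_l.-1).
Hypotheses (hK : cancel h h') (h'K : cancel h' h).

Hypothesis bipC : forall a b, C b a < 0 -> (b \in Ip) = ~~ (a \in Ip).
Hypothesis bipB : forall i j, (i \in Jp) = (j \in Jp) -> B i j = 0.
Hypothesis balB : forall i j, \sum_k path_weight B k i j = 0.
Hypothesis colourh : forall a m, (h (a, m) \in Jp) = ((a \in Ip) == ~~ odd m).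
Hypothesis exchangeB : forall (y : J -> cfield J) a (m : 'I_l.-1),
  exchange_poly B y (h (a, m)) =
    pad (y \o h) a m * pad (y \o h) a m.+2 +
    \prod_(b | C b a < 0) y (h (b, m)).

Let x := cluster_at B Jp.

(** The exchange relations hold at every vertex and every time, hence for both
    parities at once. *)
Lemma T_realisation :
  exists f : {rmorphism Tring C l -> cfield J},
    forall a (m : 'I_l.-1) u, f (T C l a m.+1 u) = x u (h (a, m)).
Proof.
pose v (g : Tletter I l) := match g with
  | inl (a, m, u) => x u (h (a, m)) | inr (a, m, u) => (x u (h (a, m)))^-1 end.
have [f fE] : exists f : {rmorphism Tfree I l -> cfield J},
    forall g, f (Tvar g) = v g := free_lift v.
have fT a m u : f (Tgen l a m u) = pad (x u \o h) a m.
  case: m => [|m] /=; first exact: rmorph1.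
  by case: insub => [j|]; [exact: fE | exact: rmorph1].
have frel r : Trel C r -> f r = 0.
  case=> [[[a m] u]|a m u /andP[]].
    move: (fE (inl (a, m, u))) (fE (inr (a, m, u))).
    (* Only the values of f on the two letters matter from here on. *)
    move: (Tvar (inl _)) (Tvar (inr _)) => s t /= fs ft.
    by rewrite rmorph_inverse fs ft divff ?subrr // cluster_neq0.
  case: m => // m _ ml.
  have ml' : (m < l.-1)%N by rewrite ltn_predRL.
  (* Likewise, only the values of f on the generators matter. *)
  move: (@Tgen I l) fT => g fg.
  rewrite rmorph_exchange rmorph_prod 4!fg -[m]/(val (Ordinal ml')).
  under eq_bigr do rewrite fg /pad valK.
  rewrite [in X in X * _]/pad [in X in _ * X - _]/pad !valK /=.
  by rewrite cluster_exchange // exchangeB subrr.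
have [g gE] := ring_mod_lift frel.
by exists g => a m u; rewrite /T /Tproj gE fT /pad valK.
Qed.

(* The parity condition, with b standing for eps = 1, in terms of the colour of
   the vertex. *)
Let good (b : bool) (i : J) (u : int) := ((i \in Jp) (+) odd (absz u)) = b.

Lemma parity_sign (eps : int) a (m : 'I_l.-1) u : eps = 1 \/ eps = -1 ->
  part_sign Ip a * (-1) ^ (m.+1%:Z + 1 + u) = eps <->
  good (eps == 1) (h (a, m)) u.
Proof.
move=> epsE.
have signE (n : int) : (-1) ^ n = (-1) ^+ odd (absz n) :> int.
  case: n => n; first by rewrite signr_odd.
  by rewrite NegzE -exprnN abszN -[in LHS]signr_odd invr_sign.
rewrite signE /good colourh /part_sign.
have oddE (k : nat) :
  odd (absz (k.+1%:Z + 1 + u)) = odd k (+) odd (absz u) by lia.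
rewrite oddE.
by case: epsE => ->; case: (a \in Ip); case: (odd m); case: (odd (absz u));
  split=> //; move/eqP.
Qed.

(* The time in {0, 1} or {-1, 0}, according to b, at which i has the right
   parity.  The step between 0 and that time fixes i, so x_i there is still the
   initial variable. *)
Let start (b : bool) (i : J) : int :=
  if b then (i \notin Jp)%:Z else - (i \in Jp)%:Z.

Lemma cluster_start b i : x (start b i) i = cvar i.
Proof.
have := cluster_step bipB balB; rewrite -/x => step.
rewrite /start; case: b; case: (boolP (i \in Jp)) => iJ //=.
  by have := step 0 i; rewrite (negPf iJ) /= add0r.
by have := step (-1) i; rewrite iJ /= addNr => <-.
Qed.

(** Two consecutive times determine all others, in both directions: T at
    [u + 1] is the right-hand side at [u] divided by the unit T at [u - 1], and
    conversely. *)
Lemma good_is_quot b (E : {rmorphism mpoly #|J| int -> Tring C l}) :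
    (forall a (m : 'I_l.-1),
       exists p, E p = T C l a m.+1 (start b (h (a, m)))) ->
  forall u a (m : 'I_l.-1), good b (h (a, m)) u -> is_quot E (T C l a m.+1 u).
Proof.
move=> Einit.
pose Q u := forall a (m : 'I_l.-1),
  good b (h (a, m)) u -> is_quot E (T C l a m.+1 u).
suff Q2 : forall u, Q u /\ Q (u + 1) by move=> u; case: (Q2 u).
have rhs u : Q u -> forall a (m : 'I_l.-1), good b (h (a, m)) (u + 1) ->
    is_quot E (T C l a m.+1 (u - 1) * T C l a m.+1 (u + 1)).
  move=> Qu a m am.
  rewrite T_rel /=; last by rewrite -ltn_predRL.
  pose G z := is_quot E z; apply: (@is_quot_subring _ _ _ G) => //.
  have odd1 : odd (absz (u + 1)) = ~~ odd (absz u) by lia.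
  have GT k : odd k = ~~ odd m.+1 -> T C l a k u \in subring_pred G.
    case: k => [_|k /= km]; first by rewrite /T rmorph1 rpred1.
    case: (ltnP k l.-1) => kl; last first.
      by rewrite /T /Tgen insubF ?rmorph1 ?rpred1 // ltnNge kl.
    apply/asboolP/in_subring_gen/(Qu a (Ordinal kl)).
    move: am; rewrite /good !colourh odd1 /= => <-; move: km.
    by case: (odd k); case: (odd m); case: (a \in Ip); case: (odd _).
  suff /asboolP : T C l a m u * T C l a m.+2 u +
      \prod_(c | C c a < 0) T C l c m.+1 u \in subring_pred G by [].
  rewrite rpredD ?rpredM ?GT //= ?negbK // rpred_prod // => c ca.
  apply/asboolP/in_subring_gen/Qu.
  move: am; rewrite /good !colourh odd1 (bipC ca).
  by case: (odd m); case: (a \in Ip); case: (odd _).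
have good2 i u : good b i (u + 1) = good b i (u - 1).
  by rewrite /good; congr (_ (+) _ = _); lia.
pose c : int := if b then 0 else -1.
have start_good i u : u = c \/ u = c + 1 -> good b i u -> u = start b i.
  by rewrite /good /start /c; case: (b); case: (i \in Jp) => /=; lia.
have Q_start u : u = c \/ u = c + 1 -> Q u.
  move=> uc a m am; rewrite (start_good _ _ uc am).
  by have [p <-] := Einit a m; apply: is_quot_image.
apply: (int_ind_both (c := c)) => [|u [Qu Qu1]|u [Qu Qu1]].
- by split; apply: Q_start; [left | right].
- split=> // a m am; have [z zE] := T_ord_inv a m u.
  apply: (is_quot_div _ zE); first by apply: Qu; rewrite -(addrK 1 u) -good2.
  by have := rhs _ Qu1 a m am; rewrite addrK.
- rewrite subrK; split=> // a m am; have [z zE] := T_ord_inv a m (u + 1).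
  rewrite -good2 in am; apply: (is_quot_div _ zE); first exact: Qu1.
  by rewrite mulrC; apply: rhs.
Qed.

(** The correspondence for any belt whose exchange relations read as the
    T-system; the two cases of interest differ only in [B] and in the
    relabelling [h]. *)
Theorem Tcirc_iso_AT (eps : int) : eps = 1 \/ eps = -1 ->
  exists f : {rmorphism Tcirc C l Ip eps -> AT B Jp},
    bijective f /\
    forall a (m : 'I_l.-1) u (t : Tcirc C l Ip eps),
      part_sign Ip a * (-1) ^ (m.+1%:Z + 1 + u) = eps ->
      val t = T C l a m.+1 u -> val (f t) = cluster_at B Jp u (h (a, m)).
Proof.
move=> epsE; pose b := eps == 1; have [f fE] := T_realisation.
pose g (k : 'I_#|J|) : Tfree I l :=
  let: (a, m) := h' (enum_val k) in Tvar (inl (a, m, start b (enum_val k))).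
pose E0 : {rmorphism mpoly #|J| int -> Tfree I l} := mpoly.mmap intr g.
pose E : {rmorphism mpoly #|J| int -> Tring C l} := @Tproj I C l \o E0.
have EX a m : E 'X_(enum_rank (h (a, m))) = T C l a m.+1 (start b (h (a, m))).
  by rewrite /= mpoly.mmapX mpoly.mmap1U /g enum_rankK hK /T Tgen_ord.
(* f turns the evaluation at the initial T's into the embedding of polynomials
   in the field of rational functions. *)
have fEE p : f (E p) = tofrac (map_mpoly intr p).
  pose F : {rmorphism mpoly #|J| int -> cfield J} := f \o E.
  pose F' : {rmorphism mpoly #|J| int -> cfield J} :=
    @tofrac _ \o map_mpoly intr.
  suff: F p = F' p by [].
  have FX i : F 'X_i = F' 'X_i.
    rewrite -(enum_valK i) -(h'K (enum_val i)); case: (h' _) => a m.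
    by rewrite -[F _]/(f (E _)) EX fE cluster_start /= map_mpolyX.
  have FM (c : int) (m : 'X_{1..#|J|}) : F (c *: 'X_[m]) = F' (c *: 'X_[m]).
    rewrite -mul_mpolyC mpolyXE_id -[c]intz rmorph_int.
    rewrite !rmorphM !rmorph_int !rmorph_prod; congr (_ * _).
    by apply: eq_bigr => i _; rewrite !rmorphXn FX.
  by rewrite (mpolyE p) !raddf_sum; apply: eq_bigr => m _; exact: FM.
have E_inj p : f (E p) = 0 -> p = 0.
  rewrite fEE => /eqP; rewrite tofrac_eq0 => /eqP p0; apply/mpolyP => m.
  have /(congr1 (fun q : mpoly #|J| rat => q@_m)) := p0.
  by rewrite mcoeff_map_mpoly !mcoeff0 => /eqP; rewrite intr_eq0 => /eqP.
have fgen k : (0 < k < l)%N -> exists m : 'I_l.-1, k = m.+1.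
  by case: k => // k; rewrite -ltn_predRL => kl; exists (Ordinal kl).
have [||y|f' f'_bij f'E] := @subring_gen_iso _ _ f (@Tcirc_gens I C l Ip eps)
  (fun y => exists i u, y = cluster_at B Jp u i).
- move=> _ [a [k [u [/fgen[m ->] _ ->]]]]; rewrite fE.
  by apply: in_subring_gen; exists (h (a, m)), u.
- move=> _ [i [u ->]].
  (* If i has the wrong parity at u, move to the neighbouring time on the side
     where the step fixes i. *)
  have [w iw xw] : exists2 w, good b i w & x w i = x u i.
    have step := cluster_step bipB balB.
    case: (boolP ((i \in Jp) (+) odd (absz u) == b)) => [/eqP|] iu.
      by exists u.
    case: (boolP ((i \in Jp) == ~~ odd (absz u))) => iu'.
      exists (u - 1); first by rewrite /good; move: iu iu'; lia.
      have := step (u - 1) i; rewrite subrK ifN //.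
      by move: iu'; lia.
    exists (u + 1); first by rewrite /good; move: iu iu'; lia.
    by have := step u i; rewrite ifN.
  move: iw xw; rewrite -(h'K i); case: (h' i) => a m.
  move=> /(parity_sign a m w epsE) iw xw.
  exists (T C l a m.+1 w); last by rewrite fE xw.
  apply: in_subring_gen; exists a, m.+1, w; split=> //.
  by rewrite /= -ltn_predRL.
- move=> Gy; apply: (is_quot_inj (f := f) E_inj).
  apply: is_quot_subring Gy => _ [a [k [u [/fgen[m ->] amu ->]]]].
  apply: (@good_is_quot b); last exact/parity_sign.
  by move=> a' m'; exists 'X_(enum_rank (h (a', m'))); rewrite EX.
- by exists f'; split=> // a m u t _ tE; rewrite f'E tE fE.
Qed.

End Realisation.

(** * The exchange matrices *)

Lemma exchange_poly_sign (J : finType) (B D : J -> J -> int) (b : bool)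
    (y : J -> cfield J) k :
    (forall j, B j k = (-1) ^+ b * D j k) ->
  exchange_poly B y k = exchange_poly D y k.
Proof.
case: b => BD; last by apply: eq_exchange_poly => // j; rewrite BD mul1r.
rewrite -[RHS]exchange_polyN.
by apply: eq_exchange_poly => // j; rewrite BD mulN1r.
Qed.

Section Matrices.
Variables (I : finType) (C : I -> I -> int) (Ip : {set I}).
Hypothesis lacedC : simply_laced C.
Hypothesis bipartiteC : bipartite C Ip.

Lemma adjacent_parts a b : C a b < 0 -> (a \in Ip) = ~~ (b \in Ip).
Proof.
by move/bipartiteC; rewrite !inE; case: (a \in Ip); case: (b \in Ip).
Qed.

Lemma laced_parts a b :
  (a \in Ip) != (b \in Ip) -> C a b = - (C a b < 0)%R%:R.
Proof.
move=> ab; have /lacedC[->|->] // : a != b.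
by apply: contra_neq ab => ->.
Qed.

Lemma Bmat_same_part i j : (i \in Ip) = (j \in Ip) -> Bmat C Ip i j = 0.
Proof. by rewrite /Bmat !inE => ->; case: (j \in Ip). Qed.

(** Each term vanishes, as every vertex is a source or a sink. *)
Lemma Bmat_balanced i j : \sum_k path_weight (Bmat C Ip) k i j = 0.
Proof.
apply: big1 => k _; rewrite /path_weight /Bmat !inE.
have := @laced_parts i k; have := @laced_parts k j.
case: (i \in Ip); case: (k \in Ip); case: (j \in Ip) => //= Ckj Cik;
  rewrite ?(mul0r, mulr0, normr0, addr0) // Ckj // Cik //;
  by case: (C k j < 0); case: (C i k < 0).
Qed.

Lemma Bmat_exchange (y : I -> cfield I) a :
  exchange_poly (Bmat C Ip) y a = 1 + \prod_(b | C b a < 0) y b.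
Proof.
rewrite (@exchange_poly_sign _ _ (fun j k => (C j k < 0)%R%:R) (a \in Ip)).
  rewrite /exchange_poly addrC big_pred0; last by move=> j; case: (C j a < 0).
  congr (_ + _); apply: eq_big => j; first by case: (C j a < 0).
  by case: (C j a < 0).
move=> j; rewrite /Bmat !inE.
have := @laced_parts j a; have := @adjacent_parts j a.
case: (C j a < 0); case: (j \in Ip); case: (a \in Ip) => /= ad lc //;
  by [have := ad isT | rewrite lc].
Qed.

Section Square.
Variable n : nat.
Notation J := (I * 'I_n)%type.
Notation B := (square_prod C (@cartanA n) Ip (cartanA_plus n)).
Notation Jp := (square_plus Ip (cartanA_plus n)).
Implicit Types i j k : J.

Lemma in_square_plus j : (j \in Jp) = ((j.1 \in Ip) == ~~ odd j.2).
Proof. by rewrite !inE; case: (j.1 \in Ip); case: odd. Qed.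

Definition consecutive (p q : 'I_n) : bool := (p.+1 == q) || (q.+1 == p).

(* The two kinds of edges of the square product; which kind is positive at a
   vertex depends only on the colour of the vertex. *)
Definition C_edge i j : bool := (C i.1 j.1 < 0) && (i.2 == j.2).
Definition A_edge i j : bool := (i.1 == j.1) && consecutive i.2 j.2.

Lemma consecutive_odd p q : consecutive p q -> odd p = ~~ odd q.
Proof. by case/orP=> /eqP <- /=; rewrite ?negbK. Qed.

Lemma cartanA_odd (p q : 'I_n) :
  odd p != odd q -> cartanA p q = - (consecutive p q)%:R.
Proof.
move=> pq; rewrite /cartanA ifN; last by apply: contra_neq pq => ->.
by rewrite /consecutive; case: ifP.
Qed.

Lemma square_same_part i j : (i \in Jp) = (j \in Jp) -> B i j = 0.
Proof.
rewrite !in_square_plus /square_prod !inE.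
by case: (i.1 \in Ip); case: (j.1 \in Ip); case: (odd i.2); case: (odd j.2).
Qed.

Lemma squareE i j :
  B i j = (-1) ^+ (j \notin Jp) * ((C_edge i j)%:R - (A_edge i j)%:R).
Proof.
rewrite in_square_plus /square_prod !inE /C_edge /A_edge.
have := @laced_parts i.1 j.1; have := @adjacent_parts i.1 j.1.
have := @cartanA_odd i.2 j.2; have := @consecutive_odd i.2 j.2.
have : i.1 == j.1 -> (i.1 \in Ip) = (j.1 \in Ip) by move=> /eqP->.
have : i.2 == j.2 -> odd i.2 = odd j.2 by move=> /eqP->.
case: (i.1 \in Ip); case: (j.1 \in Ip); case: (odd i.2); case: (odd j.2);
  case: (i.1 == j.1) => e2 /= e1; rewrite ?(e1 isT) //;
  case: (i.2 == j.2) e2 => //= e2; rewrite ?(e2 isT) //;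
  case: (C i.1 j.1 < 0); case: (consecutive i.2 j.2) => /= co ca ad lc;
  rewrite ?(ca isT) ?(lc isT) //;
  by [have := ad isT | have := co isT | have := e1 isT | have := e2 isT].
Qed.

Lemma square_edge j k : C_edge k j || A_edge k j -> (k \in Jp) = ~~ (j \in Jp).
Proof.
rewrite !in_square_plus; case/orP => /andP[].
  by move=> /adjacent_parts-> /eqP->; case: (j.1 \in Ip); case: odd.
by move=> /eqP-> /consecutive_odd->; case: (j.1 \in Ip); case: odd.
Qed.

Lemma edge_excl i j : C_edge i j -> A_edge i j = false.
Proof.
rewrite /C_edge /A_edge => /andP[/adjacent_parts ij _].
by apply: contraPF ij => /andP[/eqP-> _]; case: (_ \in _).
Qed.

(** A path of length 2 from [i] to [j] counts only if it uses one edge of each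
    kind.  There are then exactly two of them, the two sides of a commuting
    square, through [(i.1, j.2)] and [(j.1, i.2)], with opposite signs. *)
Lemma square_balanced i j : \sum_k path_weight B k i j = 0.
Proof.
have pwE k : path_weight B k i j = 2 * (-1) ^+ (j \notin Jp) *
    ((A_edge i k && C_edge k j)%:R - (C_edge i k && A_edge k j)%:R).
  rewrite /path_weight !squareE.
  have := @square_edge j k; have := @edge_excl k j; have := @edge_excl i k.
  case: (C_edge k j); case: (A_edge k j) => /= ik kj k_j; rewrite ?(k_j isT);
    case: (j \in Jp); case: (k \in Jp);
    case: (C_edge i k) ik; case: (A_edge i k) => //= ik;
    by [have := ik isT | have := kj isT].
under eq_bigr do rewrite pwE.
rewrite -mulr_sumr sumrB; apply/eqP; rewrite mulf_eq0 subr_eq0.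
apply/orP; right.
have sum1 (P : pred J) k0 c : (forall k, P k = (k == k0) && c) ->
    \sum_k (P k)%:R = c%:R :> int.
  move=> PE; rewrite (bigD1 k0) //= PE eqxx big1 ?addr0 // => k /negPf kk0.
  by rewrite PE kk0.
rewrite (sum1 _ (i.1, j.2) ((C i.1 j.1 < 0) && consecutive i.2 j.2)).
  rewrite (sum1 _ (j.1, i.2) ((C i.1 j.1 < 0) && consecutive i.2 j.2)) //.
  move=> [k1 k2]; rewrite /C_edge /A_edge xpair_eqE /= [i.2 == _]eq_sym.
  case: eqVneq => [->|_]; last by rewrite !andbF.
  by case: eqVneq => [->|_]; rewrite /= ?andbT ?andbF.
move=> [k1 k2]; rewrite /C_edge /A_edge xpair_eqE /= [i.1 == _]eq_sym.
case: eqVneq => [->|_] //; case: eqVneq => [->|_]; rewrite /= ?andbF //.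
by rewrite !andbT andbC.
Qed.

Lemma square_exchange (y : J -> cfield J) a (m : 'I_n) :
  exchange_poly B y (a, m) =
  \prod_(p | consecutive p m) y (a, p) + \prod_(b | C b a < 0) y (b, m).
Proof.
rewrite (@exchange_poly_sign _ _ (fun j k => (C_edge j k)%:R - (A_edge j k)%:R)
  ((a, m) \notin Jp)); last by move=> j; exact: squareE.
rewrite /exchange_poly addrC; congr (_ + _).
  rewrite (reindex_onto (fun p => (a, p)) snd) /=; last first.
    case=> b p /=; have := @edge_excl (b, p) (a, m).
    rewrite /C_edge /A_edge /=; have [->//|_] := eqVneq b a.
    by case: (_ && _) => //= /(_ isT).
  have CE p : C_edge (a, p) (a, m) = false.
    rewrite /C_edge /=; case: (boolP (C a a < 0)) => // /adjacent_parts.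
    by case: (a \in Ip).
  apply: eq_big => p; rewrite CE /A_edge /= !eqxx ?andbT.
    by case: consecutive.
  by case: consecutive.
rewrite (reindex_onto (fun b => (b, m)) fst) /=; last first.
  case=> b p /=; rewrite /C_edge /A_edge /=.
  case: (eqVneq p m) => [->//|_]; rewrite andbF /=.
  by case: (_ && _).
have AE b : A_edge (b, m) (a, m) = false.
  rewrite /A_edge /=; case: (boolP (consecutive m m)) => [/consecutive_odd|].
    by case: odd.
  by rewrite andbF.
apply: eq_big => b; rewrite AE /C_edge /= !eqxx !andbT.
  by case: (C b a < 0).
by case: (C b a < 0).
Qed.

End Square.
End Matrices.

(** * The correspondence *)

(** The empty product accounts for the boundary values, so that the two
    neighbours of [m] become the index set of a single product below. *)
Lemma pad_prod (I : finType) (l : nat) (A : comPzRingType)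
    (y : I * 'I_l.-1 -> A) a k :
  pad y a k = \prod_(p : 'I_l.-1 | p.+1 == k) y (a, p).
Proof.
case: k => [|k] /=; first by rewrite big_pred0.
case: insubP => [p _ pk|].
  by rewrite (big_pred1 p) // => q; rewrite eqSS -pk.
rewrite -leqNgt => kl; rewrite big_pred0 // => p; rewrite eqSS.
by apply/negbTE; rewrite neq_ltn (leq_trans (ltn_ord p)).
Qed.

Lemma prod_consecutive (I : finType) (l : nat) (A : comPzRingType)
    (y : I * 'I_l.-1 -> A) a (m : 'I_l.-1) :
  \prod_(p | consecutive p m) y (a, p) = pad y a m * pad y a m.+2.
Proof.
rewrite !pad_prod (bigID (fun p : 'I_l.-1 => p.+1 == m)) /=.
by congr (_ * _); apply: eq_bigl => p; rewrite /consecutive;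
  case: eqVneq => [pm|] //=; rewrite ?andbF ?andbT ?eqSS 1?eq_sym //=; lia.
Qed.

Theorem corollary6p20 (I : finType) (C : I -> I -> int) (Ip : {set I})
    (eps : int) :
  gen_cartan C -> simply_laced C -> bipartite C Ip -> eps = 1 \/ eps = -1 ->
  (exists f : {rmorphism Tcirc C 2 Ip eps -> AT (Bmat C Ip) Ip},
      bijective f /\
      forall (a : I) (u : int) (t : Tcirc C 2 Ip eps),
        part_sign Ip a * (-1) ^ (1%:Z + 1 + u) = eps ->
        val t = T C 2 a 1 u ->
        val (f t) = cluster_at (Bmat C Ip) Ip u a)
  /\
  (forall l : nat, (3 <= l)%N ->
    let B := square_prod C (@cartanA l.-1) Ip (cartanA_plus l.-1) in
    let Jp := square_plus Ip (cartanA_plus l.-1) in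
    exists f : {rmorphism Tcirc C l Ip eps -> AT B Jp},
      bijective f /\
      forall (a : I) (m : 'I_l.-1) (u : int) (t : Tcirc C l Ip eps),
        part_sign Ip a * (-1) ^ (m.+1%:Z + 1 + u) = eps ->
        val t = T C l a m.+1 u ->
        val (f t) = cluster_at B Jp u (a, m)).
Proof.
move=> _ lacedC bipC epsE; split=> [|l _ B Jp].
  pose h (am : I * 'I_2.-1) := am.1.
  have hK : cancel h (fun a => (a, ord0)) by case=> a m; rewrite /h ord1.
  have colourh a (m : 'I_2.-1) : (h (a, m) \in Ip) = ((a \in Ip) == ~~ odd m).
    by rewrite ord1 /=; case: (a \in Ip).
  have exchangeB (y : I -> cfield I) a (m : 'I_2.-1) :
      exchange_poly (Bmat C Ip) y (h (a, m)) =
      pad (y \o h) a m * pad (y \o h) a m.+2 +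
      \prod_(b | C b a < 0) y (h (b, m)).
    by rewrite ord1 Bmat_exchange // /pad insubF // mulr1.
  have [f [f_bij fE]] := Tcirc_iso_AT hK (fun=> erefl)
    (fun a b => @adjacent_parts _ _ _ bipC b a) (@Bmat_same_part _ C Ip)
    (Bmat_balanced Ip lacedC) colourh exchangeB epsE.
  by exists f; split=> // a u t; apply: (fE a ord0 u t).
apply: (Tcirc_iso_AT (h := id) (h' := id)) => //.
- by move=> a b; apply: adjacent_parts.
- exact: square_same_part.
- exact: square_balanced.
- by move=> a m; rewrite in_square_plus.
- by move=> y a m; rewrite square_exchange // prod_consecutive.
Qed.
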